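(* Let $T$ be a tree with $n \geq 2$ vertices. Then $\gamma_{\mathrm{m}}^{\infty}(T) = \gamma(T)$ if and only if $T$ is a corona.
   Context: All graphs are finite. For a graph $G=(V,E)$, an $\mathrm{m}$-eternal dominating set game is played as follows. The defender chooses a set $D_1\subseteq V$ of vertices occupied by guards (at most one guard per vertex). For each $i\ge 1$, the attacker (who sees the guard positions) chooses a vertex $r_i\in V\setminus D_i$, and the defender responds by letting each guard either stay in place or move to an adjacent vertex, producing a new set $D_{i+1}$ (again with at most one guard per vertex, so $|D_{i+1}|=|D_i|$) with $r_i\in D_{i+1}$. Every $D_i$ is required to be a dominating set. The $\mathrm{m}$-eternal domination number $\gamma_{\mathrm{m}}^{\infty}(G)$ is the least number of guards with which the defender can successfully respond to every infinite sequence of attacks. $\gamma(G)$ is the domination number of $G$. If $G$ has vertex set $\{v_1,\ldots,v_m\}$, then $\mathit{corona}(G)$ is the graph with the $2m$ vertices $v_1,\ldots,v_m,v_1',\ldots,v_m'$ and edge set $E(G)\cup\{v_iv_i' : 1\le i\le m\}$. A graph $H$ is a corona if it is (isomorphic to) the corona of some graph $G$. *)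

(* Defs.v *)
From mathcomp Require Import all_boot boolp.

Set Implicit Arguments.
Unset Strict Implicit.
Unset Printing Implicit Defensive.

Record sgraph := SGraph {
  vertex :> finType;
  adj : rel vertex;
  adj_sym : symmetric adj;
  adj_irrefl : irreflexive adj
}.
Arguments adj {s}.

Definition connected_graph (G : sgraph) : Prop := forall x y : G, connect adj x y.

Definition acyclic_graph (G : sgraph) : Prop :=
  forall c : seq G, 2 < size c -> ~ ucycle adj c.

Definition is_tree (G : sgraph) : Prop :=
  [/\ 0 < #|G|, connected_graph G & acyclic_graph G].

Definition graph_iso (G H : sgraph) : Prop :=
  exists2 f : G -> H, bijective f & forall x y, adj (f x) (f y) = adj x y.

(* [inl v] is the original vertex v, [inr v] the pendant vertex v'. *)
Definition corona_rel (G : sgraph) : rel (G + G) := fun u v =>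
  match u, v with
  | inl x, inl y => adj x y
  | inl x, inr y => x == y
  | inr x, inl y => x == y
  | inr _, inr _ => false
  end.

Lemma corona_rel_sym (G : sgraph) : symmetric (@corona_rel G).
Proof. by move=> [x|x] [y|y] //=; rewrite ?[x == y]eq_sym // adj_sym. Qed.

Lemma corona_rel_irrefl (G : sgraph) : irreflexive (@corona_rel G).
Proof. by move=> [x|x] //=; rewrite adj_irrefl. Qed.

Definition corona (G : sgraph) : sgraph :=
  SGraph (@corona_rel_sym G) (@corona_rel_irrefl G).

Definition is_corona (H : sgraph) : Prop :=
  exists G : sgraph, graph_iso H (corona G).

Definition dominating (G : sgraph) (D : {set G}) : bool :=
  [forall x, (x \in D) || [exists y in D, adj x y]].

Definition dom_num (G : sgraph) : nat :=
  #|[arg min_(D < [set: G] | dominating D) #|D|]|.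

(* The guard on x moves to [f x]; injectivity on D is the rule that no two
   guards end on the same vertex. *)
Definition guard_move (G : sgraph) (D D' : {set G}) : Prop :=
  exists f : G -> G,
    [/\ {in D, forall x, f x = x \/ adj x (f x)},
        {in D &, injective f}
      & f @: D = D'].

(* A strategy maps the attacks made so far (oldest first) to the current set of
   occupied vertices. The defender's earlier positions are determined by the
   earlier attacks, so they need not be recorded in the history; and against a
   fixed strategy, an attacker who sees the guards is the same thing as an
   arbitrary sequence of attacks. *)
Definition strategy (G : sgraph) := seq G -> {set G}.

Definition position (G : sgraph) (s : strategy G) (r : nat -> G) (i : nat) :
  {set G} := s (mkseq r i).

(* The defender is bound only as long as all attacks so far were on unoccupied
   vertices, but is bound at every such stage: illegal replies cannot be
   excused by their leaving the attacker without a legal continuation. *)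
Definition winning (G : sgraph) (s : strategy G) : Prop :=
  dominating (s [::]) /\
  forall (r : nat -> G) (i : nat),
    (forall j, j <= i -> r j \notin position s r j) ->
    [/\ guard_move (position s r i) (position s r i.+1),
        r i \in position s r i.+1
      & dominating (position s r i.+1)].

Definition defendable (G : sgraph) (k : nat) : Prop :=
  exists2 s : strategy G, #|s [::]| = k & winning s.

Lemma dominatingT (G : sgraph) : dominating [set: G].
Proof. by apply/forallP => x; rewrite inE. Qed.

Lemma defendable_card (G : sgraph) : exists k, `[< defendable G k >].
Proof.
exists #|G|; apply/asboolP; exists (fun=> [set: G]); first exact: cardsT.
split; first exact: dominatingT.
by move=> r i /(_ i (leqnn i)); rewrite inE.
Qed.

Definition m_eternal_dom_num (G : sgraph) : nat := ex_minn (defendable_card G).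

(* Main.v *)
(** If the vertices are perfectly matched so that every pair contains a leaf,
    the defender keeps exactly one guard in each pair, and every dominating set
    meets each pair, so both numbers equal the number of pairs.

    Conversely, let the defender win with minimum dominating sets. Minimality
    puts exactly one guard on a leaf and its neighbour, and no vertex has two
    leaf neighbours. So the end of a longest path is a leaf l whose neighbour s
    has degree 2; let p be the other neighbour of s. Deleting l and s from the
    tree and from all guard positions leaves a winning family of minimum
    dominating sets with one guard less, so by induction the smaller tree is a
    corona. Finally p can be taken to be an original vertex of that corona:
    otherwise s could dominate p in place of the neighbour of p, which would
    save a guard. *)
Require Import Defs.
From mathcomp Require Import all_boot boolp.

Set Implicit Arguments.
Unset Strict Implicit.
Unset Printing Implicit Defensive.

(** * Domination number and eternal domination number *)

Lemma dominatingP (G : sgraph) (D : {set G}) :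
  reflect (forall x, x \in D \/ exists2 y, y \in D & adj x y) (dominating D).
Proof.
apply: (iffP forallP) => H x.
  by have /orP[|/exists_inP[y yD xy]] := H x; [left | right; exists y].
by apply/orP; have [|[y yD xy]] := H x; [left | right; apply/exists_inP; exists y].
Qed.

Lemma dom_num_le (G : sgraph) (D : {set G}) : dominating D -> dom_num G <= #|D|.
Proof.
move=> domD; rewrite /dom_num; case: arg_minnP => [|E _]; first exact: dominatingT.
exact.
Qed.

Lemma dom_num_witness (G : sgraph) :
  exists2 D : {set G}, dominating D & #|D| = dom_num G.
Proof.
rewrite /dom_num; case: arg_minnP => [|E domE _]; first exact: dominatingT.
by exists E.
Qed.

(** The initial position of a winning strategy is already a dominating set. *)
Lemma dom_num_le_m_eternal (G : sgraph) : dom_num G <= m_eternal_dom_num G.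
Proof.
rewrite /m_eternal_dom_num; case: ex_minnP => k /asboolP[s <- [doms _]] _.
exact: dom_num_le.
Qed.

Lemma m_eternal_le (G : sgraph) k : defendable G k -> m_eternal_dom_num G <= k.
Proof.
rewrite /m_eternal_dom_num; case: ex_minnP => j _ jmin defk.
by apply: jmin; apply/asboolP.
Qed.

Lemma card_guard_move (G : sgraph) (D D' : {set G}) : guard_move D D' -> #|D'| = #|D|.
Proof. by move=> [f [_ finj <-]]; rewrite card_in_imset. Qed.

(** * Induced subgraphs *)

Definition induced_rel (G : sgraph) (S : {set G}) : rel {x : G | x \in S} :=
  fun u v => adj (val u) (val v).

Lemma induced_sym (G : sgraph) (S : {set G}) : symmetric (@induced_rel G S).
Proof. by move=> u v; rewrite /induced_rel adj_sym. Qed.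

Lemma induced_irrefl (G : sgraph) (S : {set G}) : irreflexive (@induced_rel G S).
Proof. by move=> u; rewrite /induced_rel adj_irrefl. Qed.

Definition induced (G : sgraph) (S : {set G}) : sgraph :=
  SGraph (@induced_sym G S) (@induced_irrefl G S).

Lemma induced_acyclic (G : sgraph) (S : {set G}) :
  acyclic_graph G -> acyclic_graph (induced S).
Proof.
move=> acG c c_gt2 /andP[cyc_c uniq_c].
apply: (acG (map val c)); first by rewrite size_map.
by rewrite /ucycle (map_inj_uniq val_inj) uniq_c andbT cycle_map.
Qed.

(** * Pendant matchings and the strategy they give *)

Definition pendant (G : sgraph) (l s : G) : Prop :=
  adj l s /\ forall y, adj l y -> y = s.

(** Coronas described from inside: [m] swaps $v_i$ with $v_i'$, and [L] marks the $v_i'$. The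
    marking is data because in a single edge both ends have degree one, yet only one may be
    marked. *)
Record pendant_matching (G : sgraph) (L : pred G) (m : G -> G) : Prop :=
  PendantMatching {
    mateK : involutive m;
    leaf_mate : forall x, L (m x) = ~~ L x;
    mate_pendant : forall x, L x -> pendant x (m x)
  }.

Section PendantMatching.

Variables (G : sgraph) (L : pred G) (m : G -> G).
Hypothesis pmG : pendant_matching L m.

Lemma mate_adj x : adj x (m x).
Proof.
have [Lx|NLx] := boolP (L x); first by have [] := mate_pendant pmG Lx.
have Lmx : L (m x) by rewrite (leaf_mate pmG).
by have [] := mate_pendant pmG Lmx; rewrite (mateK pmG) adj_sym.
Qed.

(** The marked vertex of a pair has its mate as only neighbour, so whatever dominates it lies in the
    pair. *)
Lemma mate_meets (D : {set G}) x : dominating D -> (x \in D) || (m x \in D).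
Proof.
move=> /dominatingP domD.
wlog Lx : x / L x => [wl|].
  have [|NLx] := boolP (L x); first exact: wl.
  by have := wl (m x); rewrite (mateK pmG) orbC; apply; rewrite (leaf_mate pmG).
have [->//|[y yD xy]] := domD x.
by have [_ /(_ _ xy) <-] := mate_pendant pmG Lx; rewrite yD orbT.
Qed.

(** Every pair has one unmarked vertex. Sending it to a vertex of [D] in the same pair is injective,
    since pairs are disjoint. *)
Lemma card_nonleaf_le (D : {set G}) : dominating D -> #|[set x | ~~ L x]| <= #|D|.
Proof.
move=> domD; pose g x := if x \in D then x else m x.
have ginj : {in [set x | ~~ L x] &, injective g}.
  move=> x y; rewrite !inE /g => NLx NLy.
  case: ifP => _; case: ifP => _ // E.
  - by move: NLx; rewrite E (leaf_mate pmG) NLy.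
  - by move: NLy; rewrite -E (leaf_mate pmG) NLx.
  - exact: (can_inj (mateK pmG)).
rewrite -(card_in_imset ginj); apply/subset_leq_card/subsetP => _ /imsetP[x _ ->].
by rewrite /g; case: ifP (mate_meets x domD) => //= ->.
Qed.

Let legal (D : {set G}) := forall x, (m x \in D) = (x \notin D).

Lemma transversal_dominating (D : {set G}) : legal D -> dominating D.
Proof.
move=> legD; apply/dominatingP => x; have [|xD] := boolP (x \in D); first by left.
by right; exists (m x); rewrite ?legD // mate_adj.
Qed.

(** On a legal [D] missing [r], the guard on [m r] slides to [r] and all others stay. *)
Definition mate_reply (D : {set G}) (r : G) : {set G} := r |: (D :\ m r).

Lemma mate_neq x : m x != x.
Proof. by apply/eqP => E; have := leaf_mate pmG x; rewrite E; case: (L x). Qed.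

Lemma mate_reply_legal D r : legal D -> legal (mate_reply D r).
Proof.
move=> legD x; rewrite !inE (inj_eq (can_inj (mateK pmG))) legD (can2_eq (mateK pmG) (mateK pmG)).
have [->|_] := eqVneq x r; first by rewrite eq_sym (negPf (mate_neq r)).
by case: eqP.
Qed.

Lemma mate_reply_move D r : legal D -> r \notin D -> guard_move D (mate_reply D r).
Proof.
move=> legD rD; exists (fun x => if x == m r then r else x); split.
- move=> x xD; case: eqP => [->|]; last by left.
  by right; rewrite adj_sym mate_adj.
- move=> x y xD yD; case: eqP => [->|_]; case: eqP => [->|_] // E.
    by rewrite -E (negPf rD) in yD.
  by rewrite E (negPf rD) in xD.
- apply/setP => z; apply/imsetP/idP => [[x xD ->]|].
    by rewrite !inE; have [|xr] := eqVneq x (m r); rewrite ?eqxx // xr xD orbT.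
  rewrite !inE => /orP[/eqP ->|/andP[zr zD]].
    by exists (m r); rewrite ?eqxx // legD.
  by exists z; rewrite // (negPf zr).
Qed.

Lemma defendable_nonleaf : defendable G #|[set x | ~~ L x]|.
Proof.
pose s := foldl mate_reply [set x | ~~ L x].
(* This holds after every history, even one with attacks on occupied vertices; hence only the last
   attack has to be legal below. *)
have legs a : legal (s a).
  elim/last_ind: a => [x|a r IH]; first by rewrite !inE (leaf_mate pmG).
  by rewrite /s foldl_rcons; apply: mate_reply_legal.
exists s => //; split; first exact: transversal_dominating (legs [::]).
move=> r i /(_ i (leqnn i)) ri; split; last exact/transversal_dominating/legs.
  by rewrite /position mkseqS /s foldl_rcons; apply: mate_reply_move.
by rewrite /position mkseqS /s foldl_rcons setU11.
Qed.

End PendantMatching.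

(** * Coronas are the graphs with a pendant matching *)

Definition corona_swap (G : sgraph) (u : corona G) : corona G :=
  match u with inl x => inr x | inr x => inl x end.

Lemma corona_pendant_matching (H : sgraph) :
  is_corona H -> exists L m, @pendant_matching H L m.
Proof.
move=> [G [f [g fK gK] fadj]].
exists (fun x => if f x is inr _ then true else false), (fun x => g (corona_swap (f x))).
split=> x; rewrite ?gK.
- by case E: (f x) => /=; rewrite -E fK.
- by case: (f x).
- case E: (f x) => [//|v] _; split; first by rewrite -fadj gK E /= eqxx.
  by move=> y; rewrite -fadj E; case F: (f y) => [w|//] /= /eqP ->; rewrite -F fK.
Qed.

(** The unmarked vertices induce the base graph, and the mate of a base vertex is its pendant
    vertex. *)
Lemma pendant_matching_corona (H : sgraph) (L : pred H) (m : H -> H) :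
  pendant_matching L m -> is_corona H.
Proof.
move=> pmH; pose G := induced [set x | ~~ L x]; exists G.
pose h (u : corona G) : H := match u with inl x => val x | inr x => m (val x) end.
have NL (v : G) : L (val v) = false by have := valP v; rewrite inE => /negPf.
have h_adj u v : adj (h u) (h v) = adj u v.
  have aux (x y : G) : adj (m (val x)) (val y) = (x == y).
    have Lmx : L (m (val x)) by rewrite (leaf_mate pmH) NL.
    have [adjm uniqm] := mate_pendant pmH Lmx.
    rewrite (mateK pmH) in adjm uniqm.
    by apply/idP/eqP => [/uniqm/esym/val_inj|<-].
  case: u v => [x|x] [y|y] //=; first by rewrite adj_sym aux eq_sym.
    exact: aux.
  apply/negP => xy; have Lmx : L (m (val x)) by rewrite (leaf_mate pmH) NL.
  have [_ /(_ _ xy) E] := mate_pendant pmH Lmx.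
  by have := NL x; rewrite -(mateK pmH (val x)) -E (leaf_mate pmH) NL.
have h_surj x : exists u, h u = x.
  have [Lx|NLx] := boolP (L x).
    have mxS : m x \in [set x | ~~ L x] by rewrite inE (leaf_mate pmH) Lx.
    by exists (inr (exist _ (m x) mxS)); rewrite /= (mateK pmH).
  have xS : x \in [set x | ~~ L x] by rewrite inE.
  by exists (inl (exist _ x xS)).
have h_inj : injective h.
  move=> [x|x] [y|y] /= E; try have {}E := can_inj (mateK pmH) E.
  - by rewrite (val_inj E).
  - by move/(congr1 L): E; rewrite (leaf_mate pmH) !NL.
  - by move/(congr1 L): E; rewrite (leaf_mate pmH) !NL.
  - by rewrite (val_inj E).
(* The isomorphism must start from [H], so a right inverse of the bijection [h] is taken. *)
have [f hK] := choice h_surj.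
exists f; last by move=> x y; rewrite -h_adj !hK.
by exists h => // u; apply: h_inj.
Qed.

(** * From strategies to families of positions *)

Definition reachable (G : sgraph) (s : strategy G) (D : {set G}) : Prop :=
  exists (r : nat -> G) i,
    (forall j, j < i -> r j \notin position s r j) /\ D = position s r i.

(** A form of winning without histories. Unlike a strategy, it passes to a smaller graph by
    restricting each position. *)
Record eternal_family (G : sgraph) (F : {set G} -> Prop) : Prop := EternalFamily {
  eternal_inhabited : exists D, F D;
  eternal_dominating : forall D, F D -> dominating D;
  eternal_reply : forall D r, F D -> r \notin D ->
    exists D', [/\ F D', guard_move D D' & r \in D']
}.

Lemma eq_position (G : sgraph) (s : strategy G) (r r' : nat -> G) i :
  (forall j, j < i -> r j = r' j) -> position s r i = position s r' i.
Proof.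
move=> E; congr s; apply/eq_in_map => j; rewrite mem_iota; exact: E.
Qed.

(** Reachable positions come from legal histories only, and these are the ones after which [winning]
    guarantees a reply. *)
Lemma reachable_eternal (G : sgraph) (s : strategy G) (x0 : G) :
  winning s -> eternal_family (reachable s).
Proof.
move=> [dom0 win]; split.
- by exists (s [::]), (fun=> x0), 0.
- move=> _ [r [[|i] [legal ->]]] //.
  by have [] := win r i (fun j ji => legal j ji).
(* The sequence [r'] repeats the history of the position and then attacks [a] at time [i]. *)
- move=> _ a [r [i [legal ->]]] aD; pose r' j := if j < i then r j else a.
  have Epos j : j <= i -> position s r' j = position s r j.
    by move=> ji; apply: eq_position => k kj; rewrite /r' (leq_trans kj ji).
  have legal' j : j <= i -> r' j \notin position s r' j.
    move=> ji; rewrite Epos // /r'; case: ltnP => [|ij]; first exact: legal.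
    by rewrite (_ : j = i) //; apply/eqP; rewrite eqn_leq ji.
  have [move' in' _] := win r' i legal'.
  exists (position s r' i.+1); split.
  + by exists r', i.+1.
  + by rewrite -Epos.
  + by move: in'; rewrite /r' ltnn.
Qed.

Lemma reachable_card (G : sgraph) (s : strategy G) (D : {set G}) :
  winning s -> reachable s D -> #|D| = #|s [::]|.
Proof.
move=> [_ win] [r [i [legal ->]]]; elim: i legal => [//|i IH] legal.
have [/card_guard_move -> _ _] := win r i (fun j ji => legal j ji).
by apply: IH => j ji; apply: legal; apply: ltnW.
Qed.

(** * Longest paths in trees *)

Lemma acyclic_path_neighbor (G : sgraph) (x z y : G) (q : seq G) :
  acyclic_graph G -> path adj x (z :: q) -> uniq (x :: z :: q) ->
  adj x y -> y \in z :: q -> y = z.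
Proof.
move=> acG pathq uniqq xy; rewrite inE => /predU1P[//|yq].
case/splitPr: yq pathq uniqq => q1 q2 pathq uniqq.
(* The chord from [y] back to [x] would close this cycle of at least three vertices. *)
case: (acG [:: x, z & rcons q1 y]); first by rewrite /= size_rcons.
move: pathq uniqq; rewrite -cat_rcons -!cat_cons cat_path cat_uniq.
move=> /andP[pathq1 _] /and3P[uniqq1 _ _]; rewrite /ucycle uniqq1 andbT.
rewrite /cycle rcons_path pathq1 /=.
by rewrite last_rcons adj_sym.
Qed.

Definition longest_path (G : sgraph) (x : G) (q : seq G) : Prop :=
  [/\ path adj x q, uniq (x :: q)
    & forall (y : G) q', path adj y q' -> uniq (y :: q') -> size q' <= size q].

Lemma longest_path_exists (G : sgraph) (x0 : G) : exists x q, @longest_path G x q.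
Proof.
pose P k := `[< exists x (q : seq G), [/\ path adj x q, uniq (x :: q) & size q = k] >].
have exP : exists k, P k by exists 0; apply/asboolP; exists x0, [::].
have ubP k : P k -> k <= #|G|.
  move=> /asboolP[x [q [_ /card_uniqP card_q <-]]].
  by apply: leq_trans (leqnSn _) _; rewrite -[_.+1]card_q max_card.
have [k /asboolP[x [q [pathq uniqq sizeq]]] kmax] := ex_maxnP exP ubP.
exists x, q; split=> // y q' pathq' uniqq'; rewrite sizeq.
by apply: kmax; apply/asboolP; exists y, q'.
Qed.

(** Another neighbour of [x] would prolong the path if it lay off it, and close a cycle if it lay on
    it. *)
Lemma longest_path_pendant (G : sgraph) (x z : G) (q : seq G) :
  acyclic_graph G -> longest_path x (z :: q) -> pendant x z.
Proof.
move=> acG [pathq uniqq maxq]; split; first by case/andP: pathq.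
move=> y xy; have [|yq] := boolP (y \in z :: q).
  exact: acyclic_path_neighbor pathq uniqq xy.
suff: size (x :: z :: q) <= size (z :: q) by rewrite ltnn.
apply: (maxq y); first by apply/andP; rewrite adj_sym.
rewrite cons_uniq uniqq andbT inE negb_or yq andbT.
by apply: contraTneq xy => ->; rewrite adj_irrefl.
Qed.

Lemma connected_subset (G : sgraph) (A : {set G}) (x : G) :
  connected_graph G -> x \in A -> (forall y z, y \in A -> adj y z -> z \in A) ->
  A = setT.
Proof.
move=> conG xA closedA; apply/setP => y; rewrite inE.
rewrite -(closed_connect _ (conG x y)) // => u v uv.
by apply/idP/idP => /closedA; apply; rewrite // adj_sym.
Qed.

(** On a longest path [x], [z], [w], ..., every neighbour [y] of [z] other than [w] can replace [x]
    as the starting point. So [y] is a leaf at [z], and uniqueness of leaves gives [y = x]. *)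
Lemma tree_pendant_path (G : sgraph) :
  is_tree G -> 2 < #|G| ->
  (forall l l' s : G, pendant l s -> pendant l' s -> l = l') ->
  exists l s p : G, [/\ pendant l s, adj s p, p != l
    & forall y, adj s y -> y = l \/ y = p].
Proof.
move=> [/card_gt0P[x0 _] conG acG] G_gt2 uniq_leaf.
have not_le2 (A : {set G}) : #|A| <= 2 -> A = setT -> False.
  by move=> /[swap] ->; rewrite cardsT leqNgt G_gt2.
have [x [q lq]] := longest_path_exists x0.
case: q lq => [|z [|w q]] lq.
- have [_ _ maxq] := lq.
  case: (@not_le2 [set x]); rewrite ?cards1 //.
  apply: (connected_subset conG (set11 x)) => y y' /set1P -> xy.
  suff: size [:: y'] <= 0 by [].
  apply: (maxq x); rewrite /= ?xy // inE andbT.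
  by apply: contraTneq xy => ->; rewrite adj_irrefl.
(* If the longest path is a single edge, its reversal is longest too. Both ends are then leaves, and
   connectedness leaves only two vertices. *)
- have [_ xz] := longest_path_pendant acG lq.
  have [_ zx] : pendant z x.
    apply: (@longest_path_pendant _ _ _ [::]) => //.
    case: lq => pathq uniqq maxq; split=> //; first by rewrite /= adj_sym.
    by move: uniqq; rewrite /= !inE eq_sym.
  case: (@not_le2 [set x; z]); first by rewrite cards2; case: (_ != _).
  apply: (connected_subset conG (set21 x z)) => y y' /set2P[->|->].
    by move/xz ->; rewrite set22.
  by move/zx ->; rewrite set21.
- have lxz := longest_path_pendant acG lq.
  have [/and3P[xz zw pathq] uniqq maxq] := lq.
  exists x, z, w; split=> //.
    by apply: contraTneq uniqq => ->; rewrite /= !inE eqxx orbT.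
  move=> y zy; have [->|yw] := eqVneq y w; [by right | left].
  apply: (uniq_leaf _ _ z) => //; apply: (@longest_path_pendant _ _ _ (w :: q)) => //.
  have uniqz : uniq (z :: w :: q) by case/andP: uniqq.
  have pathz : path adj z (w :: q) by rewrite /= zw.
  split=> //; first by rewrite /= adj_sym zy zw.
  rewrite cons_uniq uniqz andbT inE negb_or.
  apply/andP; split; first by apply: contraTneq zy => ->; rewrite adj_irrefl.
  apply: contraNN yw => /(acyclic_path_neighbor acG pathz uniqz zy) ->.
  exact: eqxx.
Qed.

(** * Eternal families of minimum dominating sets *)

Section MinimumEternalFamily.

Variables (G : sgraph) (F : {set G} -> Prop).
Hypothesis eternalF : eternal_family F.
Hypothesis minimumF : forall D E : {set G}, F D -> dominating E -> #|D| <= #|E|.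

(** With neither vertex occupied, [l] is undominated. With both, the guard on [l] is redundant, as
    [s] covers all that [l] covers; this contradicts minimality. *)
Lemma eternal_pendant (l s : G) (D : {set G}) : pendant l s -> F D -> (s \in D) = (l \notin D).
Proof.
move=> [ls luniq] FD; have /dominatingP domD := eternal_dominating eternalF FD.
have [lD|lD] := boolP (l \in D); last first.
  by have [|[y yD /luniq <-]] := domD l; first by rewrite (negPf lD).
apply/negP => sD; suff: #|D| <= #|D :\ l| by rewrite (cardsD1 l D) lD ltnn.
have sNl : s != l by apply: contraTneq ls => ->; rewrite adj_irrefl.
apply: (minimumF FD); apply/dominatingP => x.
have [->|xl] := eqVneq x l; first by right; exists s => //; rewrite !inE sNl.
have [->|xs] := eqVneq x s; first by left; rewrite !inE sNl.
have [xD|[y yD xy]] := domD x; first by left; rewrite !inE xl.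
right; exists y => //; rewrite !inE yD andbT.
by apply: contraNneq xs => yl; apply/eqP/luniq; rewrite adj_sym -yl.
Qed.

Lemma eternal_meets x : exists2 D, F D & x \in D.
Proof.
have [D FD] := eternal_inhabited eternalF.
have [xD|xD] := boolP (x \in D); first by exists D.
by have [D' [FD' _ xD']] := eternal_reply eternalF FD xD; exists D'.
Qed.

(** Some position has a guard on [l]. Then [s] is empty, which forces a guard on [l'] as well, and a
    single guard on [s] would do the work of both. *)
Lemma eternal_leaf_unique (l l' s : G) : pendant l s -> pendant l' s -> l = l'.
Proof.
move=> ls l's; apply/eqP/negPn/negP => ll'.
have [D FD lD] := eternal_meets l.
have sD : s \notin D by rewrite (eternal_pendant ls FD) lD.
have l'D : l' \in D by rewrite -[_ \in _]negbK -(eternal_pendant l's FD).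
have l'Dl : l' \in D :\ l by rewrite !inE eq_sym ll'.
suff: #|D| <= #|s |: ((D :\ l) :\ l')|.
  rewrite cardsU1 (cardsD1 l D) lD (cardsD1 l' (D :\ l)) l'Dl.
  by rewrite !add1n ltnNge; case: (_ \notin _); rewrite ?leqnn // leqnSn.
have /dominatingP domD := eternal_dominating eternalF FD.
case: ls l's => [ls luniq] [l's l'uniq].
apply: (minimumF FD); apply/dominatingP => x.
have [->|xs] := eqVneq x s; first by left; rewrite setU11.
have [->|xl] := eqVneq x l; first by right; exists s; rewrite ?setU11.
have [->|xl'] := eqVneq x l'; first by right; exists s; rewrite ?setU11.
have [xD|[y yD xy]] := domD x; first by left; rewrite !inE xl xl' xD orbT.
right; exists y => //; rewrite !inE yD andbT.
apply/orP; right; apply/andP; split; apply: contraNneq xs => yl; apply/eqP.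
  by apply: l'uniq; rewrite adj_sym -yl.
by apply: luniq; rewrite adj_sym -yl.
Qed.

(** * Deleting a leaf together with its neighbour of degree two *)

Section DeletePendantPath.

Variables l s p : G.
Hypotheses (pend_ls : pendant l s) (sp : adj s p) (pl : p != l).
Hypothesis s_nbrs : forall y, adj s y -> y = l \/ y = p.

Let S := ~: [set l; s].
Let G' := induced S.

Let ps : p != s.
Proof. by apply: contraTneq sp => ->; rewrite adj_irrefl. Qed.

Let sl : s != l.
Proof. by case: pend_ls => ls _; apply: contraTneq ls => ->; rewrite adj_irrefl. Qed.

Let lsE x : (x \in S) = (x != l) && (x != s).
Proof. by rewrite !inE negb_or. Qed.

Let pS : p \in S.
Proof. by rewrite lsE pl ps. Qed.

Let p' : G' := exist _ p pS.

(** A retraction of [G] onto [G']: the default value [p'] is taken exactly at [l] and [s]. *)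
Definition fold_pair (x : G) : G' := insubd p' x.

Lemma val_fold x : val (fold_pair x) = if x \in S then x else p.
Proof. exact: val_insubd. Qed.

Lemma fold_val (u : G') : fold_pair (val u) = u.
Proof. exact: valKd. Qed.

(** The only edges meeting the deleted pair are [l]-[s] and [s]-[p], and both collapse to [p'].
    Folding thus turns walks into walks and guard moves into guard moves. *)
Lemma fold_adj x y :
  adj x y -> fold_pair x = fold_pair y \/ adj (fold_pair x) (fold_pair y).
Proof.
have aux u : adj l u || adj s u -> fold_pair u = p'.
  case: pend_ls => ls luniq /orP[/luniq|/s_nbrs[]] ->; apply: val_inj;
  by rewrite val_fold lsE ?eqxx ?andbF //= ?pl ?ps.
have fold_l : fold_pair l = p'.
  by apply: aux; case: pend_ls => [+ _]; rewrite (adj_sym s) => ->; rewrite orbT.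
have fold_s : fold_pair s = p' by apply: aux; case: pend_ls => -> _.
wlog xS : x y / x \in S.
  move=> wl xy; have [xS|] := boolP (x \in S); first exact: wl.
  rewrite lsE negb_and !negbK => xls.
  left; rewrite (aux y); first by case/orP: xls => /eqP ->.
  by case/orP: xls xy => /eqP -> ->; rewrite ?orbT.
move=> xy; have [yS|] := boolP (y \in S).
  by right; rewrite /= /induced_rel !val_fold xS yS.
rewrite lsE negb_and !negbK => yls.
left; rewrite (aux x); first by case/orP: yls => /eqP ->.
by case/orP: yls xy => /eqP ->; rewrite adj_sym => ->; rewrite ?orbT.
Qed.

Lemma delete_tree : is_tree G -> is_tree G'.
Proof.
move=> [_ conG acG]; split; first by apply/card_gt0P; exists p'.
- move=> u v; have /connectP[q pathq vq] := conG (val u) (val v).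
  rewrite -(fold_val u) -(fold_val v) vq.
  elim: q (val u) pathq {vq} => [|y q IH] x /=; first by rewrite connect0.
  move=> /andP[xy /IH]; apply: connect_trans.
  by have [->|/connect1//] := fold_adj xy; rewrite connect0.
- exact: induced_acyclic.
Qed.

Lemma card_delete : #|G| = #|G'|.+2.
Proof. by rewrite card_sig -(cardsC [set l; s]) cards2 eq_sym sl. Qed.

(* If s alone dominated p, an attack on p would draw the guard off s, and no
   guard could then reach s or l. *)
Lemma eternal_dominates_neighbor D :
  F D -> p \in D \/ exists2 y, y \in D & (y != s) && adj p y.
Proof.
move=> FD; have [pD|pD] := boolP (p \in D); [by left | right].
have [D' [FD' [f [fmove finj fD]] pD']] := eternal_reply eternalF FD pD.
move: pD'; rewrite -fD => /imsetP[y yD pE]; exists y => //.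
have py : adj p y.
  by case: (fmove y yD); rewrite -pE; [move=> E; rewrite -E (negPf pD) in yD | rewrite adj_sym].
rewrite py andbT; apply/negP => /eqP ys; rewrite {}ys in yD pE py.
have lD : l \notin D by rewrite -(eternal_pendant pend_ls FD).
have : (s \in D') || (l \in D') by rewrite (eternal_pendant pend_ls FD') orNb.
suff no u : u \in D' -> (u == s) || (u == l) -> False.
  by case/orP => /no; apply; rewrite eqxx ?orbT.
rewrite -fD => /imsetP[g gD ->] fg.
have gs : g != s by apply: contraTneq fg => ->; rewrite -pE (negPf ps) (negPf pl).
have gl : g != l by apply: contraTneq gD => ->.
have gp : g != p by apply: contraTneq gD => ->.
case: pend_ls => _ luniq.
case/orP: fg => /eqP fg; case: (fmove g gD); rewrite fg.
- by move=> E; rewrite -E eqxx in gs.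
- by rewrite adj_sym => /s_nbrs[]/eqP; rewrite ?(negPf gl) ?(negPf gp).
- by move=> E; rewrite -E eqxx in gl.
- by rewrite adj_sym => /luniq/eqP; rewrite (negPf gs).
Qed.

Definition restrict (D : {set G}) : {set G'} := [set u | val u \in D].

(** By [eternal_pendant], exactly one guard stands on the deleted pair. *)
Lemma card_restrict D : F D -> #|D| = #|restrict D|.+1.
Proof.
move=> FD; rewrite -(cardsID [set l; s] D) -add1n; congr (_ + _).
  have slD := eternal_pendant pend_ls FD.
  have [lD|lD] := boolP (l \in D).
    rewrite (_ : _ :&: _ = [set l]) ?cards1 //; apply/setP => x; rewrite !inE.
    have [->|_] := eqVneq x l; first by rewrite lD.
    by have [->|_] := eqVneq x s; rewrite ?andbF // slD lD.
  rewrite (_ : _ :&: _ = [set s]) ?cards1 //; apply/setP => x; rewrite !inE.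
  have [->|_] := eqVneq x l; first by rewrite (negPf lD) eq_sym (negPf sl).
  by have [->|_] := eqVneq x s; rewrite ?andbF // slD lD.
rewrite -(card_imset _ val_inj); apply: eq_card => x.
rewrite in_setD; apply/andP/imsetP => [[xS xD]|[u]].
  have xS' : x \in S by rewrite inE.
  by exists (exist _ x xS' : G'); rewrite ?inE.
by rewrite inE => uD ->; split=> //; have := valP u; rewrite inE.
Qed.

(** Among the remaining vertices only [p] is adjacent to the deleted pair, through [s], and
    [eternal_dominates_neighbor] gives it another dominator. *)
Lemma restrict_dominating D : F D -> dominating (restrict D).
Proof.
move=> FD; have /dominatingP domD := eternal_dominating eternalF FD.
have nbr (u : G') y : adj (val u) y -> y != s -> y \in D ->
    exists2 v, v \in restrict D & adj u v.
  move=> uy ys yD; have yS : y \in S.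
    rewrite lsE ys andbT; apply: contraTneq (valP u) => yl.
    rewrite lsE negb_and !negbK; apply/orP; right.
    by case: pend_ls => _ luniq; apply/eqP/luniq; rewrite adj_sym -yl.
  by exists (exist _ y yS : G'); rewrite ?inE.
apply/dominatingP => u; have [up|up] := eqVneq u p'.
  have [pD|[y yD /andP[ys py]]] := eternal_dominates_neighbor FD.
    by left; rewrite inE up.
  by right; apply: (nbr u y) => //; rewrite up.
have [uD|[y yD uy]] := domD (val u); first by left; rewrite inE.
right; apply: (nbr u y) => //; apply: contraNneq up => ys.
have := valP u; rewrite lsE => /andP[ul _].
rewrite ys adj_sym in uy; case: (s_nbrs uy) => E; first by rewrite E eqxx in ul.
exact/eqP/val_inj.
Qed.

(* A guard leaving p for s can only be trading places with the guard of the
   pair; folding turns the exchange into a guard standing still. *)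
Lemma restrict_move D D' :
  F D -> F D' -> guard_move D D' -> guard_move (restrict D) (restrict D').
Proof.
move=> FD FD' [f [fmove finj fD]].
have slD := eternal_pendant pend_ls FD; have slD' := eternal_pendant pend_ls FD'.
case: pend_ls => ls luniq.
have fimg x : x \in D -> f x \in D' by move=> xD; rewrite -fD imset_f.
(* The pair's guard [g] cannot end on [s], which is taken, nor on [l], since [s] and [l] are never
   both occupied. Only [p] is left. *)
have exchange : p \in D -> f p = s -> exists g, [/\ g \in D, g \notin S & f g = p].
  move=> pD fps; have sD' : s \in D' by rewrite -fps fimg.
  have [g gD gS] : exists2 g, g \in D & g \notin S.
    have [lD|lD] := boolP (l \in D); first by exists l; rewrite // lsE eqxx.
    by exists s; rewrite ?slD // lsE eqxx andbF.
  exists g; split=> //.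
  have fgl : f g != l.
    by apply: contraTneq sD' => E; rewrite slD' -E fimg.
  have fgs : f g != s.
    apply: contraNneq gS => E; suff -> : g = p by [].
    by apply: finj; rewrite // E.
  move: gS fgl fgs; rewrite lsE negb_and !negbK => /orP[]/eqP gE.
    case: (fmove g gD) => [->|]; first by rewrite gE eqxx.
    by rewrite gE => /luniq ->; rewrite eqxx.
  case: (fmove g gD) => [->|]; first by rewrite gE eqxx.
  by rewrite gE => /s_nbrs[->|//]; rewrite eqxx.
have exits (u : G') : val u \in D -> f (val u) \notin S -> val u = p /\ f (val u) = s.
  move=> uD; have := valP u; rewrite !lsE negb_and !negbK => /andP[ul us].
  move=> /orP[]/eqP fu; case: (fmove _ uD); rewrite fu.
  - by move=> E; rewrite -E eqxx in ul.
  - by rewrite adj_sym => /luniq E; rewrite E eqxx in us.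
  - by move=> E; rewrite -E eqxx in us.
  - by rewrite adj_sym => /s_nbrs[E|//]; rewrite E eqxx in ul.
have finj' : {in restrict D &, injective (fun u => fold_pair (f (val u)))}.
  (* A guard going from [p] to [s] is folded back to [p]. No guard of [S] moves to [p] at the same
     time, because [g] does. *)
  have aux (u v : G') : val u \in D -> val v \in D -> f (val u) \notin S ->
      f (val v) \in S -> p != f (val v).
    move=> uD vD fuS fvS; have [up us] := exits u uD fuS.
    rewrite up in uD us; have [g [gD gS gp]] := exchange uD us.
    apply: contraNneq gS => E; suff -> : g = val v by exact: (valP v).
    by apply: finj; rewrite // gp.
  move=> u v; rewrite !inE => uD vD /(congr1 val); rewrite !val_fold.
  case: ifPn => fuS; case: ifPn => fvS E.
  - exact/val_inj/finj.
  - by have := aux v u vD uD fvS fuS; rewrite -E eqxx.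
  - by have := aux u v uD vD fuS fvS; rewrite E eqxx.
  - apply: val_inj; have [-> _] := exits u uD fuS.
    by have [-> _] := exits v vD fvS.
exists (fun u => fold_pair (f (val u))); split=> //.
- move=> u; rewrite inE => uD.
  case: (fmove _ uD) => [->|/fold_adj]; first by left; rewrite fold_val.
  by rewrite fold_val; case=> [<-|]; [left | right].
(* Both restrictions have one guard less than positions of equal size, so inclusion suffices. *)
- apply/eqP; rewrite eqEcard card_in_imset //.
  apply/andP; split; last first.
    rewrite -ltnS -(card_restrict FD) -(card_restrict FD').
    by rewrite -fD card_in_imset.
  apply/subsetP => _ /imsetP[u + ->]; rewrite inE => uD.
  rewrite inE val_fold; case: ifPn => fuS; first exact: fimg.
  have [up us] := exits u uD fuS; rewrite up in uD us.
  by have [g [gD _ <-]] := exchange uD us; apply: fimg.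
Qed.

Definition restrict_family (E : {set G'}) : Prop := exists2 D, F D & E = restrict D.

Lemma restrict_eternal : eternal_family restrict_family.
Proof.
split.
- by have [D FD] := eternal_inhabited eternalF; exists (restrict D), D.
- by move=> _ [D FD ->]; apply: restrict_dominating.
- move=> _ r [D FD ->]; rewrite inE => rD.
  have [D' [FD' DD' rD']] := eternal_reply eternalF FD rD.
  exists (restrict D'); split; first by exists D'.
    exact: restrict_move.
  by rewrite inE.
Qed.

(** The added guard on [s] covers [l], [s] and [p], so [E] is excused from dominating [p']. *)
Lemma extend_dominating (E : {set G'}) :
  (forall u, [\/ u = p', u \in E | exists2 v, v \in E & adj u v]) ->
  dominating (s |: val @: E).
Proof.
move=> domE; apply/dominatingP => x.
have [xS|] := boolP (x \in S); last first.
  rewrite lsE negb_and !negbK => /orP[]/eqP ->; last by left; rewrite setU11.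
  by right; exists s; rewrite ?setU11 //; case: pend_ls.
have [/(congr1 val) /= ->|xE|[v vE xv]] := domE (exist _ x xS).
- by right; exists s; rewrite ?setU11 // adj_sym.
- by left; rewrite inE (imset_f val xE) orbT.
- by right; exists (val v) => //; rewrite inE imset_f // orbT.
Qed.

Lemma card_extend (E : {set G'}) : #|s |: val @: E| <= #|E|.+1.
Proof. by rewrite cardsU1 card_imset; [case: (_ \notin _) | exact: val_inj]. Qed.

Lemma restrict_minimum (D E : {set G'}) : restrict_family D -> dominating E -> #|D| <= #|E|.
Proof.
move=> [D0 FD0 ->] /dominatingP domE; rewrite -ltnS -(card_restrict FD0).
apply: leq_trans (card_extend E); apply: (minimumF FD0); apply: extend_dominating.
by move=> u; have [uE|uE] := domE u; [apply: Or32 | apply: Or33].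
Qed.

(* Otherwise p is the leaf of q := m p, and q has a second neighbour z, which
   dominates q. Then s may take over p from q: the vertices that are not leaves,
   without q, together with s dominate G. *)
Lemma mate_neighbor_unique (L : pred G') (m : G' -> G') :
  pendant_matching L m -> L p' -> forall z, adj (m p') z -> z = p'.
Proof.
move=> pm Lp z qz; apply/eqP/negPn/negP => zp.
(* The only neighbour of a marked [z] is its mate; here that would be [m p'], giving [z = p']. *)
have NLz : ~~ L z.
  apply: contraNN zp => Lz; have [_ zuniq] := mate_pendant pm Lz.
  rewrite -(inj_eq (can_inj (mateK pm))); apply/eqP/esym/zuniq.
  by rewrite adj_sym.
have zq : z != m p' by apply: contraTneq qz => ->; rewrite adj_irrefl.
pose C := [set u | ~~ L u]; pose E := C :\ m p'.
have [D FD] := eternal_inhabited eternalF.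
have qC : m p' \in C by rewrite inE (leaf_mate pm) negbK.
have : #|D| <= #|E|.+1.
  apply: leq_trans (card_extend E); apply: (minimumF FD); apply: extend_dominating.
  move=> u; have [->|up] := eqVneq u p'; first exact: Or31.
  have [->|uq] := eqVneq u (m p').
    by apply: Or33; exists z; rewrite // !inE zq.
  have [Lu|NLu] := boolP (L u); last by apply: Or32; rewrite !inE uq.
  apply: Or33; exists (m u); last exact: (mate_adj pm).
  by rewrite !inE (leaf_mate pm) Lu (inj_eq (can_inj (mateK pm))) up.
(* This yields [#|D| <= #|C| <= #|restrict D|], although [D] has one guard more than its
   restriction. *)
rewrite -[_.+1]/(1 + _) (_ : 1 + #|E| = #|C|); last by rewrite (cardsD1 (m p') C) qC.
have := card_nonleaf_le pm (restrict_dominating FD).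
by rewrite (card_restrict FD) => CD /leq_trans/(_ CD); rewrite ltnn.
Qed.

(** The new pair is [l], [s] with [l] marked. Since [p] gains the neighbour [s], it must be
    unmarked; if it is marked, the marks of [p'] and [m p'] are exchanged first, which is possible
    because [p'] is then the only neighbour of [m p']. *)
Lemma extend_pendant_matching :
  (exists L m, @pendant_matching G' L m) -> exists L m, @pendant_matching G L m.
Proof.
move=> [L0 [m pm0]].
have [L pm NLp] : exists2 L, pendant_matching L m & ~~ L p'.
  have [Lp|] := boolP (L0 p'); last by exists L0.
  have quniq := mate_neighbor_unique pm0 Lp.
  have pq := mate_neq pm0 p'.
  exists (fun u => if u == p' then false else if u == m p' then true else L0 u);
    last by rewrite eqxx.
  split=> u; first exact: (mateK pm0).
    rewrite (can2_eq (mateK pm0) (mateK pm0)) (inj_eq (can_inj (mateK pm0))).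
    have [->|_] := eqVneq u p'; first by rewrite eq_sym (negPf pq).
    by have [_|_] := eqVneq u (m p'); last exact: (leaf_mate pm0).
  have [//|up] := eqVneq u p'; have [->|uq Lu] := eqVneq u (m p').
    by move=> _; split; [exact: (mate_adj pm0) | rewrite (mateK pm0)].
  exact: (mate_pendant pm0).
have [ls luniq] := pend_ls.
(* Here [fold_pair] only retypes vertices of [S]; the values at [l] and [s] are fixed by the
   equality tests. *)
pose L1 x := (x == l) || (x != s) && L (fold_pair x).
pose m1 x := if x == l then s else if x == s then l else val (m (fold_pair x)).
have valS (u : G') : (val u == l) = false /\ (val u == s) = false.
  by have := valP u; rewrite lsE => /andP[/negPf ? /negPf ?].
have L1val u : L1 (val u) = L u.
  by have [ul us] := valS u; rewrite /L1 ul us fold_val.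
have m1val u : m1 (val u) = val (m u).
  by have [ul us] := valS u; rewrite /m1 ul us fold_val.
have m1l : m1 l = s by rewrite /m1 eqxx.
have m1s : m1 s = l by rewrite /m1 (negPf sl) eqxx.
have L1l : L1 l by rewrite /L1 eqxx.
have L1s : L1 s = false by rewrite /L1 (negPf sl) eqxx.
have cases x : [\/ x = l, x = s | exists u : G', x = val u].
  have [->|xl] := eqVneq x l; first exact: Or31.
  have [->|xs] := eqVneq x s; first exact: Or32.
  have xS : x \in S by rewrite lsE xl.
  by apply: Or33; exists (exist _ x xS).
exists L1, m1; split=> x; have [->|->|[u ->]] := cases x.
- by rewrite m1l.
- by rewrite m1s.
- by rewrite !m1val (mateK pm).
- by rewrite m1l L1s L1l.
- by rewrite m1s L1s L1l.
- by rewrite m1val !L1val (leaf_mate pm).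
- by rewrite m1l.
- by rewrite L1s.
- rewrite L1val m1val => Lu; have [um uuniq] := mate_pendant pm Lu.
  split=> // y; have [->|->|[v ->]] := cases y.
  + by rewrite adj_sym => /luniq E; have [_] := valS u; rewrite E eqxx.
  + rewrite adj_sym => /s_nbrs[] E; first by have [] := valS u; rewrite E eqxx.
    have up : u = p' by apply: val_inj.
    by rewrite -up Lu in NLp.
  + by move=> /uuniq ->.
Qed.

End DeletePendantPath.

End MinimumEternalFamily.

(** * Induction on the tree, and the equivalence *)

Lemma eternal_tree_pendant_matching (G : sgraph) (F : {set G} -> Prop) :
  is_tree G -> 1 < #|G| -> eternal_family F ->
  (forall D E : {set G}, F D -> dominating E -> #|D| <= #|E|) ->
  exists L m, @pendant_matching G L m.
Proof.
(* The family varies in the induction along with the tree, to allow passing to [restrict_family]. *)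
have [n] := ubnP #|G|; elim: n G F => [//|n IH] G F Gn treeG G_gt1 etF minF.
have [G_le2|G_gt2] := leqP #|G| 2.
  have /card_gt1P[a [b [_ _ ab]]] := G_gt1.
  have abE x : (x == b) = (x != a).
    have: x \in [set a; b].
      suff -> : [set a; b] = setT by rewrite inE.
      by apply/eqP; rewrite eqEcard subsetT cardsT cards2 ab.
    by rewrite !inE => /orP[]/eqP->; rewrite eqxx ?(negPf ab) // eq_sym ab.
  have [_ conG _] := treeG.
  have abadj : adj a b.
    have /connectP[[|y q] /=] := conG a b; first by move=> _ E; rewrite E eqxx in ab.
    move=> /andP[ay _] _; suff /eqP <- : y == b by [].
    by rewrite abE; apply: contraTneq ay => ->; rewrite adj_irrefl.
  exists (pred1 a), (fun x => if x == a then b else a); split=> x /=.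
  - by have [->|] := eqVneq x a; rewrite ?eqxx ?(eq_sym b) ?(negPf ab) // -abE => /eqP.
  - by have [_|] := eqVneq x a; rewrite ?eqxx // eq_sym (negPf ab).
  - move=> /eqP ->; rewrite eqxx; split=> // y ay.
    by apply/eqP; rewrite abE; apply: contraTneq ay => ->; rewrite adj_irrefl.
have [l [s [p [ls sp pl s_nbrs]]]] :=
  tree_pendant_path treeG G_gt2 (eternal_leaf_unique etF minF).
have cardG := card_delete ls.
apply: (extend_pendant_matching etF minF ls sp pl s_nbrs).
apply: (IH _ (@restrict_family G F l s)).
- by rewrite -ltnS -cardG ltnW.
- exact: (delete_tree ls sp pl s_nbrs).
(* If only [p] remained, it would be a second leaf at [s]. *)
- rewrite ltnNge; apply/negP => G'_le1; rewrite cardG in G_gt2.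
  have G'1 : #|induced (~: [set l; s])| = 1.
    by apply/eqP; rewrite eqn_leq G'_le1 -ltnS -ltnS.
  suff /(eternal_leaf_unique etF minF ls)/eqP : pendant p s.
    by rewrite eq_sym (negPf pl).
  split=> [|y py]; first by rewrite adj_sym.
  apply/eqP/negPn/negP => ys.
  have ps : p != s by apply: contraTneq sp => ->; rewrite adj_irrefl.
  have yl : y != l.
    by apply: contraNneq ps => yl; case: ls => _ luniq; apply/eqP/luniq; rewrite adj_sym -yl.
  have yS : y \in ~: [set l; s] by rewrite !inE negb_or yl.
  have pS : p \in ~: [set l; s] by rewrite !inE negb_or pl.
  have /fintype_le1P/(_ (exist _ y yS)) := G'_le1.
  move=> /(_ (exist _ p pS))/(congr1 val) /= yp.
  by rewrite yp adj_irrefl in py.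
- exact: (restrict_eternal etF minF ls sp pl s_nbrs).
- exact: (restrict_minimum etF minF ls sp pl).
Qed.

Theorem theorem4p2 (T : sgraph) (T_tree : is_tree T) (n_ge2 : 2 <= #|T|) :
  m_eternal_dom_num T = dom_num T <-> is_corona T.
Proof.
split=> [eq_num|/corona_pendant_matching[L [m pm]]].
  have [x0 _] : exists x0 : T, x0 \in T by apply/card_gt0P; case: T_tree.
  move: eq_num; rewrite /m_eternal_dom_num; case: ex_minnP => k /asboolP[s <- win] _ sk.
  have [L [m pm]] : exists L m, @pendant_matching T L m.
    apply: (eternal_tree_pendant_matching T_tree n_ge2 (reachable_eternal x0 win)).
    (* Guards are never lost, so every reachable position has [dom_num T] of them. *)
    by move=> D E /(reachable_card win) -> domE; rewrite sk dom_num_le.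
  exact: pendant_matching_corona pm.
apply/eqP; rewrite eqn_leq dom_num_le_m_eternal andbT.
have [D domD <-] := dom_num_witness T.
(* The number of pairs separates the two quantities: it suffices for defence and bounds every
   dominating set from below. *)
exact: leq_trans (m_eternal_le (defendable_nonleaf pm)) (card_nonleaf_le pm domD).
Qed.
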